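(* Let $X$ be a generalized continuum. Then $X$ admits an efficient exhaustion by compacta $\{K_i\}$.
   Context: A generalized continuum is a Hausdorff space that is connected, locally connected, $\sigma$-compact (a union of countably many compact subspaces), and locally compact. Connected implies nonempty. A subset of $X$ is bounded if its closure in $X$ is compact, and unbounded otherwise. An exhaustion of $X$ by compacta is a sequence $K_1\subseteq K_2\subseteq\cdots$ (indexed by $i\in\mathbb{Z}_+$) of compact subspaces of $X$ with $X=\bigcup_iK_i$ and $K_i\subseteq\mathrm{Int}_XK_{i+1}$ for each $i$. A compactum $K\subseteq X$ is efficient if $K$ is connected (hence nonempty) and each component of $X-K$ is unbounded. An exhaustion by compacta is efficient if each $K_i$ is efficient. *)

(* Defs.v *)
From mathcomp Require Import all_boot all_classical topology.

Set Implicit Arguments.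
Unset Strict Implicit.
Unset Printing Implicit Defensive.

Local Open Scope classical_set_scope.

Definition locally_connected (X : topologicalType) : Prop :=
  forall (x : X) (U : set X), nbhs x U ->
    exists V : set X, [/\ open V, V x, V `<=` U & connected V].

(* A finite (or empty) union of compacta is covered by padding with set0. *)
Definition sigma_compact (X : topologicalType) : Prop :=
  exists2 C : nat -> set X, forall i, compact (C i) & \bigcup_i C i = [set: X].

(* The library's [connected] holds of [set0], whereas here connectedness
   includes nonemptiness. *)
Record generalized_continuum (X : topologicalType) : Prop := {
  gc_hausdorff : hausdorff_space X;
  gc_nonempty : [set: X] !=set0;
  gc_connected : connected [set: X];
  gc_locally_connected : locally_connected X;
  gc_sigma_compact : sigma_compact X;
  gc_locally_compact : locally_compact [set: X]
}.

Definition bounded_subset (X : topologicalType) (A : set X) : Prop :=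
  compact (closure A).

(* [K i] stands for the (i + 1)-st term of a sequence indexed by the positive
   integers. *)
Record exhaustion_by_compacta (X : topologicalType) (K : nat -> set X) : Prop := {
  exh_compact : forall i, compact (K i);
  exh_nested : forall i, K i `<=` K i.+1;
  exh_cover : \bigcup_i K i = [set: X];
  exh_interior : forall i, K i `<=` interior (K i.+1)
}.

(* [connected_component A x] is empty when [x] is not in [A], so components of
   the complement of [K] are taken at points outside [K] only. *)
Record efficient (X : topologicalType) (K : set X) : Prop := {
  eff_compact : compact K;
  eff_nonempty : K !=set0;
  eff_connected : connected K;
  eff_unbounded : forall x, (~` K) x ->
    ~ bounded_subset (connected_component (~` K) x)
}.

Definition efficient_exhaustion (X : topologicalType) (K : nat -> set X) : Prop :=
  exhaustion_by_compacta K /\ forall i, efficient (K i).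

(* Main.v *)
Require Import Defs.
From mathcomp Require Import all_boot all_classical topology.

(** Any compactum [C] lies in the interior of a connected compactum [L], and
    filling [L] by adding the bounded components of its complement yields an
    efficient compactum. The filling is compact because, for a compact
    neighbourhood [M] of [L], every component of [~` L] meets the compact
    frontier of [M] or lies inside [M] (the closure of such a component must
    touch [L]), and only finitely many of these disjoint open components meet
    the frontier. *)

Set Implicit Arguments.
Unset Strict Implicit.
Unset Printing Implicit Defensive.

Local Open Scope classical_set_scope.

(** Compactness as an induction principle: the sets [A] with [P (K \ A)] form a filter, proper if
    [P K] fails. It then clusters at some point of [K], but the complement of a good neighbourhood
    of that point belongs to the filter. *)
Lemma compact_ind (X : topologicalType) (P : set X -> Prop) (K : set X) :
  compact K -> P set0 -> (forall A B, P A -> P B -> P (A `|` B)) ->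
  (forall A B, A `<=` B -> P B -> P A) ->
  (forall x, K x -> exists2 U, nbhs x U & P U) -> P K.
Proof.
move=> coK P0 PU PS PK; apply: contrapT => nPK.
pose F : set_system X := [set A | P (K `\` A)].
have FF : ProperFilter F.
  split; first by rewrite /F /= setD0.
  split=> [|A B FA FB|A B AB]; rewrite /F /= ?setDT ?setDIr //.
    exact: PU.
  by apply: PS; exact: setDS.
have [|x [Kx clFx]] := coK F FF; first by rewrite /F /= setDv.
have [U xU PUx] := PK _ Kx.
have [|y []//] := clFx (~` U) U _ xU.
by apply: PS PUx => y [_]; rewrite /= => /contrapT.
Qed.

Lemma connected_component_open (X : topologicalType) (A : set X) x :
  locally_connected X -> open A -> open (connected_component A x).
Proof.
move=> lcX oA; rewrite openE => y Axy.
have [V [oV Vy VA cV]] := lcX y A (open_nbhs_nbhs (conj oA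
  (connected_component_sub Axy))).
apply: filterS (open_nbhs_nbhs (conj oV Vy)).
rewrite (same_connected_component Axy).
exact: connected_component_max.
Qed.

(** If the closure missed [K], it would be a connected subset of the complement, so the component
    would be closed. It is open as well, hence all of [X], which leaves no room for [K]. *)
Lemma closure_component_meets (X : topologicalType) (K : set X) x :
  connected [set: X] -> locally_connected X -> closed K -> K !=set0 ->
  ~ K x -> closure (connected_component (~` K) x) `&` K !=set0.
Proof.
move=> cX lcX clK [k Kk] nKx; apply: contrapT => /nonemptyPn dUK.
set U := connected_component (~` K) x in dUK *.
have Ux : U x by exact: connected_component_refl.
have clU : closed U.
  apply: connected_component_max; first exact: subset_closure.
    by move=> y cUy Ky; suff : set0 y by []; rewrite -dUK.
  exact/connected_closure/component_connected.
have UT : U = setT.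
  apply: cX; first by exists x.
    by exists U; [exact/connected_component_open/closed_openC|rewrite setTI].
  by exists U => //; rewrite setTI.
have : U k by rewrite UT.
by move/connected_component_sub.
Qed.

Section generalized_continuum.
Variable X : topologicalType.
Hypothesis hX : generalized_continuum X.
Implicit Types (K L : set X) (x y : X).

Let cX := gc_connected hX.
Let lcX := gc_locally_connected hX.

Lemma nbhs_connected_bounded x :
  exists V : set X, [/\ nbhs x V, connected V & bounded_subset V].
Proof.
have [C xC [cC clC]] := gc_locally_compact hX I (x := x).
rewrite withinET in xC.
have [V [oV Vx VC cV]] := lcX xC.
exists V; split => //; first exact: open_nbhs_nbhs.
apply: subclosed_compact cC _; first exact: closed_closure.
by rewrite [X in _ `<=` X](closure_id C).1//; exact: closureS.
Qed.

(** For fixed [x], the admissible [y] form a nonempty clopen set. *)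
Lemma connected_compact_interior x y : exists C : set X,
  [/\ compact C, connected C, C x & interior C y].
Proof.
pose A := [set y | exists C : set X,
  [/\ compact C, connected C, C x & interior C y]].
suff AT : A = setT by have : A y by rewrite AT.
(* Gluing [closure V] onto the compactum for [z] moves its interior on to [w]; the two pieces share
   [z]. *)
have Aext z w V : connected V -> bounded_subset V -> V z -> nbhs w V ->
    A z -> A w.
  move=> cV bV Vz wV [C [coC cC Cx Cz]]; exists (C `|` closure V); split.
  - exact: compactU.
  - apply: connectedU => //; last exact: connected_closure.
    exists z; split; first exact: interior_subset.
    exact: subset_closure.
  - by left.
  - by apply: filterS wV => t Vt; right; exact: subset_closure.
apply: cX.
- exists x; have [V [xV cV bV]] := nbhs_connected_bounded x.
  exists (closure V); split => //; first exact: connected_closure.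
    exact/subset_closure/(nbhs_singleton xV).
  by apply: filterS xV; exact: subset_closure.
- exists A; last by rewrite setTI.
  rewrite openE => z [C [coC cC Cx Cz]].
  by apply: filterS (nbhs_interior Cz) => t Ct; exists C.
- exists A; last by rewrite setTI.
  move=> z clAz; have [V [zV cV bV]] := nbhs_connected_bounded z.
  have [t [At Vt]] := clAz V zV.
  exact: Aext cV bV Vt zV At.
Qed.

Lemma connected_compactum K : compact K -> exists L : set X,
  [/\ compact L, connected L, L !=set0 & K `<=` interior L].
Proof.
move=> coK; have [p _] := gc_nonempty hX.
(* The common base point [p] keeps unions connected in the induction below. *)
suff [L [coL cL Lp KL]] : exists L : set X,
  [/\ compact L, connected L, L p & K `<=` interior L].
  by exists L; split => //; exists p.
pattern K; apply: compact_ind coK _ _ _ _.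
- exists [set p]; split => //; [exact: compact_set1|exact: connected1].
- move=> A B [L [coL cL Lp AL]] [M [coM cM Mp BM]]; exists (L `|` M).
  split; [exact: compactU|by apply: connectedU => //; exists p|by left|].
  by move=> z [/AL|/BM] zI; apply: interiorU; [left|right].
- by move=> A B AB [L [coL cL Lp BL]]; exists L; split => // z /AB /BL.
- move=> y _; have [C [coC cC Cp Cy]] := connected_compact_interior p y.
  by exists (interior C); [exact: nbhs_interior|exists C; split].
Qed.

(* The points of [K] belong to [fill K] because [connected_component] is empty
   outside of its set argument. *)
Definition fill K : set X :=
  [set x | bounded_subset (connected_component (~` K) x)].

Lemma sub_fill K : K `<=` fill K.
Proof.
move=> x Kx; rewrite /fill /= connected_component_out; last by move=> /(_ Kx).
by rewrite /bounded_subset closure0; exact: compact0.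
Qed.

Lemma component_sub_fill K x :
  fill K x -> connected_component (~` K) x `<=` fill K.
Proof. by move=> fx y xy; rewrite /fill /= -(same_connected_component xy). Qed.

Lemma component_meets_frontier_or_sub K L x : closed K -> K !=set0 ->
  closed L -> K `<=` interior L ->
  (exists2 y, (L `\` interior L) y & connected_component (~` K) x y) \/
  connected_component (~` K) x `<=` L.
Proof.
move=> clK K0 clL KL.
have [Kx|nKx] := pselect (K x).
  by right; rewrite connected_component_out//; apply.
have [|nF] :=
  pselect (exists2 y, (L `\` interior L) y & connected_component (~` K) x y).
  by left.
right; set U := connected_component (~` K) x in nF *.
have sep : separated (interior L) (~` L).
  split; apply/disjoints_subset; rewrite ?setCK.
    rewrite [X in _ `<=` X](closure_id L).1//.
    by apply: closureS; exact: interior_subset.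
  by rewrite closure_setC setCK.
have UD : U `<=` interior L `|` ~` L.
  move=> y Uy; have [Ly|] := pselect (L y); last by right.
  by left; apply: contrapT => nLy; apply: nF; exists y.
have [UL|UL] := connected_subset sep UD (@component_connected _ _ _).
  by move=> y /UL; exact: interior_subset.
(* A component inside the complement of [L] is impossible: its closure reaches some [k] in [K], and
   [interior L] is a neighbourhood of [k]. *)
have [k [Uk Kk]] := closure_component_meets cX lcX clK K0 nKx.
have [z [/UL nLz]] := Uk _ (nbhs_interior (KL _ Kk)).
by move=> /interior_subset /nLz.
Qed.

Lemma fill_bounded K : compact K -> K !=set0 ->
  exists2 C : set X, compact C & fill K `<=` C.
Proof.
move=> coK K0; have hsX := gc_hausdorff hX.
have clK := compact_closed hsX coK.
have [L [coL _ _ KL]] := connected_compactum coK.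
have clL := compact_closed hsX coL.
(* A single compactum contains all bounded components that meet the frontier. Stated for subsets of
   the frontier, this passes to finite unions, so it need only be checked locally. *)
have [C coC FC] : exists2 C : set X, compact C &
    forall y, (L `\` interior L) y -> fill K y ->
      connected_component (~` K) y `<=` C.
  have coF : compact (L `\` interior L).
    by apply: compact_closedI => //; exact/open_closedC/open_interior.
  pattern (L `\` interior L); apply: compact_ind coF _ _ _ _.
  - by exists set0 => //; exact: compact0.
  - move=> A B [C coC AC] [D coD BD]; exists (C `|` D); first exact: compactU.
    move=> y [Ay|By] fy z yz; first by left; exact: AC yz.
    by right; exact: BD yz.
  - by move=> A B AB [C coC BC]; exists C => // y /AB; exact: BC.
  (* The component of [y] is itself the neighbourhood: all its points share one component, covered
     by its closure if bounded and imposing no condition otherwise. *)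
  - move=> y [Ly nLy]; exists (connected_component (~` K) y).
      apply: open_nbhs_nbhs; split.
        exact/connected_component_open/closed_openC.
      by apply: connected_component_refl => /KL.
    have [fy|nfy] := pselect (fill K y).
      exists (closure (connected_component (~` K) y)) => //.
      move=> z yz _; rewrite -(same_connected_component yz).
      exact: subset_closure.
    exists set0; first exact: compact0.
    by move=> z yz; rewrite /fill /= -(same_connected_component yz).
exists (L `|` C); first exact: compactU.
move=> x fx; have [Kx|nKx] := pselect (K x).
  by left; exact: interior_subset (KL _ Kx).
have [[y Fy xy]|UL] := component_meets_frontier_or_sub x clK K0 clL KL;
  last first.
  by left; apply: UL; exact: connected_component_refl.
right; apply: (FC _ Fy); first exact: component_sub_fill xy.
exact: connected_component_sym.
Qed.

(** The complement of [fill K] is the union of the unbounded components of the complement of [K],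
    which are open. *)
Lemma fill_closed K : closed K -> closed (fill K).
Proof.
move=> clK; rewrite -openC openE => x nfx.
have nKx : ~ K x by move=> /sub_fill.
have : nbhs x (connected_component (~` K) x).
  apply: open_nbhs_nbhs; split; last exact: connected_component_refl.
  exact/connected_component_open/closed_openC.
apply: filterS => y xy fy; apply: nfx.
by apply: component_sub_fill fy _ _; exact: connected_component_sym.
Qed.

Lemma fill_connected K :
  closed K -> K !=set0 -> connected K -> connected (fill K).
Proof.
move=> clK K0 cK; have [k Kk] := K0.
(* Components are replaced by their closures, which still lie in the closed set [fill K] but now
   touch [K]; thus every piece is connected and contains [K]. *)
have -> : fill K =
    \bigcup_(x in fill K) (K `|` closure (connected_component (~` K) x)).
  apply/seteqP; split => [x fx|y [x fx [/sub_fill//|]]]; last first.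
    rewrite [X in _ -> X y](closure_id (fill K)).1; last exact: fill_closed.
    by apply: closureS; exact: component_sub_fill.
  exists x => //; have [Kx|nKx] := pselect (K x); first by left.
  by right; apply: subset_closure; exact: connected_component_refl.
apply: bigcup_connected; first by exists k => x _; left.
move=> x fx; have [Kx|nKx] := pselect (K x).
  by rewrite connected_component_out ?closure0 ?setU0 //; apply.
apply: connectedU => //; last exact/connected_closure/component_connected.
by rewrite setIC; exact: closure_component_meets.
Qed.

Lemma fill_efficient K :
  compact K -> K !=set0 -> connected K -> efficient (fill K).
Proof.
move=> coK K0 cK; have clK := compact_closed (gc_hausdorff hX) coK.
split.
- have [C coC fC] := fill_bounded coK K0.
  exact: subclosed_compact (fill_closed clK) coC fC.
- by have [k Kk] := K0; exists k; exact: sub_fill.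
- exact: fill_connected.
(* The component of [x] in the complement of [K] avoids [fill K], so it lies in the component
   considered here and would inherit its boundedness. *)
- move=> x nfx bx; apply: (nfx); rewrite /fill /=.
  apply: subclosed_compact bx _; first exact: closed_closure.
  apply/closureS/connected_component_max.
  + by apply: connected_component_refl => /sub_fill.
  + move=> y xy fy; apply: nfx.
    by apply: component_sub_fill fy _ _; exact: connected_component_sym.
  + exact: component_connected.
Qed.

Lemma efficient_compactum K : compact K -> exists L : set X,
  efficient L /\ K `<=` interior L.
Proof.
move=> /connected_compactum[L [coL cL L0 KL]]; exists (fill L).
split; first exact: fill_efficient.
by move=> x /KL; apply: interiorS; exact: sub_fill.
Qed.

End generalized_continuum.

Theorem theorem2p9 (X : topologicalType) (hX : generalized_continuum X) :
  exists K : nat -> set X, efficient_exhaustion K.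
Proof.
have [C coC CT] := gc_sigma_compact hX.
(* Choice needs a total function on sets, so [f] takes a junk value at noncompact arguments. *)
have /choice[f fP] : forall A : set X, exists L : set X,
    compact A -> efficient L /\ A `<=` interior L.
  move=> A; have [/(efficient_compactum hX)[L LP]|nA] := pselect (compact A).
    by exists L.
  by exists set0.
(* Absorbing [C m.+1] along with [K m] at each stage makes the sequence cover [X]; [C 0] is absorbed
   by the initial term. *)
pose K := fix K n := if n is m.+1 then f (K m `|` C m.+1) else f (C 0%N).
have effK n : efficient (K n).
  elim: n => [|n IH] /=; first by have [] := fP _ (coC 0%N).
  by have [] := fP _ (compactU (eff_compact IH) (coC n.+1)).
have KS n : K n `|` C n.+1 `<=` interior (K n.+1).
  by have [] := fP _ (compactU (eff_compact (effK n)) (coC n.+1)).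
exists K; split => //; split.
- by move=> n; exact: eff_compact.
- by move=> n x Kx; apply: interior_subset; apply: KS; left.
- apply/seteqP; split => // x _.
  have [[|n] _ Cx] : (\bigcup_i C i) x by rewrite CT.
    exists 0%N => //; apply: interior_subset.
    by have [_] := fP _ (coC 0%N); apply.
  by exists n.+1 => //; apply: interior_subset; apply: KS; right.
- by move=> n x Kx; apply: KS; left.
Qed.
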